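(* Let $M\ge0$, let $m\ge1$ be an integer, and let $\mathcal{G}_0:=\frac{\mu^2}{2^3(3L+4M)}$. Assume that $\|\nabla f(\mathbf{x}_0)\|_*\le\frac1{2^2}\mathcal{G}_0$. Then the iterates of the Regularized Newton method with Lazy Hessians (with parameters $m$ and $M$) started at $\mathbf{x}_0$ satisfy, for all $k\ge0$, $$\|\nabla f(\mathbf{x}_k)\|_*\;\le\;\mathcal{G}_0\cdot\Bigl(\frac12\Bigr)^{2(1+m/2)^{\pi(k)/m}\,(1+(k\bmod m)/2)}.$$
   Context: $\mathbf{B}\in\mathbb{R}^{d\times d}$ is a fixed symmetric positive definite matrix, $\|\mathbf{x}\|=\langle \mathbf{B}\mathbf{x},\mathbf{x}\rangle^{1/2}$, $\|\mathbf{g}\|_*=\langle \mathbf{g},\mathbf{B}^{-1}\mathbf{g}\rangle^{1/2}$ for gradients, and $\|\mathbf{A}\|=\sup_{\|\mathbf{x}\|\le1}\|\mathbf{A}\mathbf{x}\|_*$ for matrices. The function $f:\mathbb{R}^d\to\mathbb{R}$ is twice continuously differentiable, $\|\nabla^2 f(\mathbf{x})-\nabla^2 f(\mathbf{y})\|\le L\|\mathbf{x}-\mathbf{y}\|$ for all $\mathbf{x},\mathbf{y}$ with $L>0$, and $f$ is strongly convex: $\nabla^2 f(\mathbf{x})\succeq\mu\mathbf{B}$ for all $\mathbf{x}\in\mathbb{R}^d$, with $\mu>0$. Regularized Newton with Lazy Hessians: for $k=0,1,\dots$ set $\mathbf{z}_k=\mathbf{x}_{\pi(k)}$, $\lambda_k=\sqrt{M\|\nabla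 f(\mathbf{x}_k)\|_*}$ and $\mathbf{x}_{k+1}=\mathbf{x}_k-(\nabla^2 f(\mathbf{z}_k)+\lambda_k\mathbf{B})^{-1}\nabla f(\mathbf{x}_k)$, where $\pi(k)=k-(k\bmod m)$ is the largest multiple of $m$ not exceeding $k$, so that $\pi(k)/m$ is the number of completed phases. *)

(* Defs.v *)
From HB Require Import structures.
From mathcomp Require Import all_boot all_order all_algebra.
From mathcomp Require Import all_classical all_reals all_analysis.

Set Implicit Arguments.
Unset Strict Implicit.
Unset Printing Implicit Defensive.

Import Order.TTheory GRing.Theory Num.Theory.
Import numFieldNormedType.Exports.

Local Open Scope classical_set_scope.
Local Open Scope ring_scope.

Definition inner (R : realType) (d : nat) (u v : 'cV[R]_d) : R :=
  (u^T *m v) 0 0.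

Definition sym_posdef (R : realType) (d : nat) (B : 'M[R]_d) : Prop :=
  B^T = B /\ forall v : 'cV[R]_d, v != 0 -> 0 < inner (B *m v) v.

(* Loewner order [A2 <= A1].  It is only applied to symmetric matrices (the
   Hessian of a C^2 function), so symmetry of [A1 - A2] is not required. *)
Definition loewner_ge (R : realType) (d : nat) (A1 A2 : 'M[R]_d) : Prop :=
  forall v : 'cV[R]_d, 0 <= inner ((A1 - A2) *m v) v.

Definition primal_norm (R : realType) (d : nat) (B : 'M[R]_d)
    (x : 'cV[R]_d) : R :=
  Num.sqrt (inner (B *m x) x).

Definition dual_norm (R : realType) (d : nat) (B : 'M[R]_d)
    (g : 'cV[R]_d) : R :=
  Num.sqrt (inner g (invmx B *m g)).

(* When [B] is positive definite, the set below is nonempty and bounded, so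
   [sup] is its least upper bound. *)
Definition op_norm (R : realType) (d : nat) (B A : 'M[R]_d) : R :=
  sup [set dual_norm B (A *m x) | x in [set x | primal_norm B x <= 1]].

Definition gradient (R : realType) (d : nat) (f : 'cV[R]_d -> R)
    (x : 'cV[R]_d) : 'cV[R]_d :=
  \col_i 'D_(delta_mx i 0) f x.

Definition hessian (R : realType) (d : nat) (f : 'cV[R]_d -> R)
    (x : 'cV[R]_d) : 'M[R]_d :=
  \matrix_(i, j) 'D_(delta_mx j 0) ('D_(delta_mx i 0) f) x.

Definition twice_continuously_differentiable (R : realType) (d : nat)
    (f : 'cV[R]_d -> R) : Prop :=
  [/\ forall x, differentiable f x,
      forall x, differentiable (gradient f) x
    & continuous (hessian f)].

Definition hessian_lipschitz (R : realType) (d : nat) (B : 'M[R]_d) (L : R)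
    (f : 'cV[R]_d -> R) : Prop :=
  forall x y,
    op_norm B (hessian f x - hessian f y) <= L * primal_norm B (x - y).

Definition strongly_convex (R : realType) (d : nat) (B : 'M[R]_d) (mu : R)
    (f : 'cV[R]_d -> R) : Prop :=
  forall x, loewner_ge (hessian f x) (mu *: B).

Definition phase_start (m k : nat) : nat := (k - k %% m)%N.

Definition regularizer (R : realType) (d : nat) (B : 'M[R]_d) (M : R)
    (f : 'cV[R]_d -> R) (x : 'cV[R]_d) : R :=
  Num.sqrt (M * dual_norm B (gradient f x)).

(* [x] is the sequence of iterates of the method started at [x 0].  For [B]
   positive definite, [f] strongly convex and [0 <= M], the inverted matrix is
   invertible, so [invmx] is the true inverse. *)
Definition lazy_newton_iterates (R : realType) (d : nat) (B : 'M[R]_d) (M : R)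
    (m : nat) (f : 'cV[R]_d -> R) (x : nat -> 'cV[R]_d) : Prop :=
  forall k : nat,
    let z := x (phase_start m k) in
    let lambda := regularizer B M f (x k) in
    x k.+1 = x k - invmx (hessian f z + lambda *: B) *m gradient f (x k).

(* Main.v *)
Require Import Defs.
From mathcomp Require Import all_boot all_order all_algebra.
From mathcomp Require Import all_classical all_reals all_analysis.
From mathcomp Require Import ring lra.
Import Order.TTheory GRing.Theory Num.Theory.
Import numFieldNormedType.Exports.
Local Open Scope ring_scope.

(** Write [g y = |gradient f y|_*], let [x] be an iterate, [z] the snapshot of
   its phase and [h] the step taken from [x].  The mean value theorem applied to
   [t |-> <gradient f (y + t v), u>] gives strong monotonicity,
   [|x - z| <= (g x + g z) / mu], and the Taylor bound
   [|gradient f (x + h) - gradient f x - hessian f z h|_*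
      <= L (|x - z| + |h|) |h|],
   where [|h| <= g x / mu].  Hence
   [g (x + h) <= L / mu^2 (2 g x + g z) g x + sqrt (M g x) / mu * g x].
   If [g x, g z <= G0 t^2] with [t <= 1/2], the right-hand side is at most
   [t * g x]: within a phase every step gains the factor [t], the square root of
   the relative gradient norm at the snapshot. *)

(** * Mean value theorems and the Euclidean pairing *)

Lemma mean_value_line (R : realType) (V : normedModType R) (F : V -> R)
    (x h : V) :
  (forall y, differentiable F y) ->
  exists2 c : R, 0 < c < 1 & F (x + h) - F x = 'D_h F (x + c *: h).
Proof.
move=> dF; pose phi (t : R) : R := F (x + t *: h).
have dphi (t : R) : is_derive t (1 : R) phi ('D_h F (x + t *: h)).
  (* The difference quotient of [phi] at [t] is literally that of [F] at [x + t *: h] in direction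
     [h], so derivability and derivative transfer without a chain rule. *)
  have E : (fun s : R => s^-1 *: (phi (s *: (1 : R) + t) - phi t)) =
      (fun s : R => s^-1 *: (F (s *: h + (x + t *: h)) - F (x + t *: h))).
    apply/funext => s; rewrite /phi; congr (_ *: (F _ - _)).
    by rewrite scaler1 scalerDl addrCA.
  have dv : derivable F (x + t *: h) h by exact: diff_derivable.
  split; first by rewrite /derivable; rewrite E.
  by rewrite /derive E.
have [|c] := @MVT R phi (fun t => 'D_h F (x + t *: h)) 0 1 ltr01.
  apply: continuous_subspaceT => t; apply: differentiable_continuous.
  by apply/derivable1_diffP; have [] := dphi t.
rewrite in_itv /= => c01 E; exists c => //.
by move: E; rewrite /phi scale1r scale0r addr0 subr0 mulr1.
Qed.

Lemma innerE (R : realType) (d : nat) (u v : 'cV[R]_d) :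
  inner u v = \sum_i u i 0 * v i 0.
Proof. by rewrite /inner mxE; apply: eq_bigr => i _; rewrite mxE. Qed.

Section Inner.
Variables (R : realType) (d : nat).
Implicit Types (u v w : 'cV[R]_d) (A B : 'M[R]_d).

Lemma innerDl u v w : inner (u + v) w = inner u w + inner v w.
Proof. by rewrite /inner raddfD /= mulmxDl mxE. Qed.

Lemma innerZl (a : R) u v : inner (a *: u) v = a * inner u v.
Proof. by rewrite /inner linearZ /= -scalemxAl mxE. Qed.

Lemma innerC u v : inner u v = inner v u.
Proof. by rewrite !innerE; apply: eq_bigr => i _; rewrite mulrC. Qed.

Lemma innerDr u v w : inner u (v + w) = inner u v + inner u w.
Proof. by rewrite innerC innerDl !(innerC u). Qed.

Lemma innerZr (a : R) u v : inner u (a *: v) = a * inner u v.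
Proof. by rewrite innerC innerZl innerC. Qed.

Lemma innerNl u v : inner (- u) v = - inner u v.
Proof. by rewrite -scaleN1r innerZl mulN1r. Qed.

Lemma inner0l u : inner 0 u = 0.
Proof. by rewrite -[0 in LHS](scale0r 0) innerZl mul0r. Qed.

Lemma inner_mulmx_tr A u v : inner (A *m u) v = inner u (A^T *m v).
Proof. by rewrite /inner trmx_mul mulmxA. Qed.

(** A row vector in the kernel of the transpose of [A] transposes to some [v] with [A *m v = 0], and
    positivity forces [v = 0]. *)
Lemma unitmx_inner_gt0 A :
  (forall v, v != 0 -> 0 < inner (A *m v) v) -> A \in unitmx.
Proof.
move=> Apos; rewrite -unitmx_tr -row_free_unit -kermx_eq0; apply/rowV0P => v.
move=> /sub_kermxP /(congr1 trmx); rewrite trmx_mul trmxK trmx0 => Av0.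
apply/eqP; rewrite -(trmxK v) -[0]trmx0 (inj_eq trmx_inj).
apply: contraT => /Apos.
by rewrite Av0 inner0l ltxx.
Qed.

End Inner.

(** The scalar mean value theorem is applied to the pairing of the gradient with a fixed [u]. The
    point [c] depends on [u], which is harmless because dual norms are bounded by testing against
    each [u] separately. *)
Lemma gradient_mean_value (R : realType) (d : nat) (f : 'cV[R]_d -> R)
    (x h u : 'cV[R]_d) :
  (forall y, differentiable (gradient f) y) ->
  exists2 c : R, 0 < c < 1 &
    inner (gradient f (x + h) - gradient f x) u =
    inner (hessian f (x + c *: h) *m h) u.
Proof.
move=> dG.
pose G (i : 'I_d) (y : 'cV[R]_d) : R := 'D_(delta_mx i 0) f y.
have dGi i y : differentiable (G i) y.
  have -> : G i = (fun N : 'cV[R]_d => N i 0 : R) \o gradient f.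
    by apply/funext => z; rewrite /= /gradient mxE.
  by apply: differentiable_comp => //; exact: differentiable_coord.
pose F := \sum_i (u i 0 *: (G i : 'cV[R]_d -> R)).
have FE y : F y = inner (gradient f y) u.
  rewrite innerE /F fct_sumE; apply: eq_bigr => i _.
  by rewrite /gradient mxE mulrC.
have dF y : differentiable F y.
  by apply: differentiable_sum => i; apply: differentiableZ.
have [c c01 E] := @mean_value_line R _ F x h dF.
exists c => //; set y := x + c *: h in E *.
rewrite innerDl innerNl -!FE E innerE.
have -> : 'D_h F y = \sum_i u i 0 * 'D_h (G i) y.
  rewrite /F derive_sum; last by move=> i; apply/diff_derivable/differentiableZ.
  by apply: eq_bigr => i _; rewrite deriveZ //; exact/diff_derivable.
apply: eq_bigr => i _; rewrite mulrC; congr (_ * _).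
(* Expanding [h] in the standard basis, linearity of the differential produces a row of the
   Hessian. *)
rewrite mxE deriveE // {1}(matrix_sum_delta h) linear_sum /=.
apply: eq_bigr => j _.
by rewrite big_ord1 linearZ /= /hessian mxE mulrC -deriveE.
Qed.

(** * The primal, dual and operator norms of a positive definite matrix *)

Section PosDef.
Variables (R : realType) (d : nat) (B : 'M[R]_d).
Hypothesis hB : sym_posdef B.
Implicit Types (u v w g : 'cV[R]_d) (A : 'M[R]_d).

Lemma innerB_ge0 v : 0 <= inner (B *m v) v.
Proof.
have [->|/hB.2/ltW//] := eqVneq v 0.
by rewrite innerC inner0l.
Qed.

Lemma innerBC u v : inner (B *m u) v = inner (B *m v) u.
Proof. by rewrite inner_mulmx_tr hB.1 innerC. Qed.

Lemma sym_posdef_unitmx : B \in unitmx.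
Proof. by apply: unitmx_inner_gt0 => v /hB.2. Qed.

Lemma mulmxBV g : B *m (invmx B *m g) = g.
Proof. by rewrite mulmxA mulmxV ?mul1mx // sym_posdef_unitmx. Qed.

(** Passing to the Riesz representative lets the dual norm inherit the triangle inequality and
    homogeneity. *)
Lemma dual_normE g : dual_norm B g = primal_norm B (invmx B *m g).
Proof. by rewrite /primal_norm mulmxBV. Qed.

Lemma primal_norm_ge0 v : 0 <= primal_norm B v.
Proof. exact: sqrtr_ge0. Qed.

Lemma dual_norm_ge0 g : 0 <= dual_norm B g.
Proof. exact: sqrtr_ge0. Qed.

Lemma sqr_primal_norm v : primal_norm B v ^+ 2 = inner (B *m v) v.
Proof. by rewrite sqr_sqrtr // innerB_ge0. Qed.

Lemma primal_norm_gt0 v : v != 0 -> 0 < primal_norm B v.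
Proof. by move=> /hB.2; rewrite sqrtr_gt0. Qed.

Lemma primal_normZ (a : R) v : primal_norm B (a *: v) = `|a| * primal_norm B v.
Proof.
rewrite /primal_norm -scalemxAr innerZl innerZr mulrA -expr2 sqrtrM ?sqr_ge0 //.
by rewrite sqrtr_sqr.
Qed.

Lemma primal_normN v : primal_norm B (- v) = primal_norm B v.
Proof. by rewrite -scaleN1r primal_normZ normrN1 mul1r. Qed.

Lemma primal_norm0 : primal_norm B 0 = 0.
Proof.
by rewrite -[X in primal_norm _ X](scale0r 0) primal_normZ normr0 mul0r.
Qed.

Lemma cauchy_schwarz_innerB u v :
  inner (B *m u) v <= primal_norm B u * primal_norm B v.
Proof.
have [->|u0] := eqVneq u 0.
  by rewrite mulmx0 inner0l mulr_ge0 ?primal_norm_ge0.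
have [->|v0] := eqVneq v 0.
  by rewrite innerC inner0l mulr_ge0 ?primal_norm_ge0.
(* With [a], [b] the norms of [u], [v] and [p] their [B]-product, this square equals
   [2 * a * b * (a * b - p)]. *)
have := innerB_ge0 (primal_norm B v *: u - primal_norm B u *: v).
have := primal_norm_gt0 _ u0; have := primal_norm_gt0 _ v0.
have := sqr_primal_norm u; have := sqr_primal_norm v.
move: (primal_norm B u) (primal_norm B v) => a b bE aE b0 a0.
rewrite -scaleNr mulmxDr -!scalemxAr !(innerDl, innerDr, innerZl, innerZr).
rewrite -bE -aE (innerBC v u); move: (inner _ _) => p H.
suff : 0 <= (a * b) * (a * b - p) by rewrite pmulr_rge0 ?mulr_gt0 // subr_ge0.
by nra.
Qed.

Lemma primal_normD u v :
  primal_norm B (u + v) <= primal_norm B u + primal_norm B v.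
Proof.
rewrite -(@ler_pXn2r _ 2) ?nnegrE ?addr_ge0 ?primal_norm_ge0 // sqr_primal_norm.
rewrite sqrrD !sqr_primal_norm mulmxDr !innerDl !innerDr (innerBC v u).
by have := cauchy_schwarz_innerB u v; lra.
Qed.

Lemma dual_norm_inner g v : inner g v <= dual_norm B g * primal_norm B v.
Proof. by rewrite dual_normE -{1}(mulmxBV g) cauchy_schwarz_innerB. Qed.

Lemma dual_normD g v : dual_norm B (g + v) <= dual_norm B g + dual_norm B v.
Proof. by rewrite !dual_normE mulmxDr primal_normD. Qed.

Lemma dual_normZ (a : R) g : dual_norm B (a *: g) = `|a| * dual_norm B g.
Proof. by rewrite !dual_normE -scalemxAr primal_normZ. Qed.

Lemma dual_normN g : dual_norm B (- g) = dual_norm B g.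
Proof. by rewrite -scaleN1r dual_normZ normrN1 mul1r. Qed.

Lemma dual_norm_mulB v : dual_norm B (B *m v) = primal_norm B v.
Proof. by rewrite dual_normE mulmxA mulVmx ?mul1mx // sym_posdef_unitmx. Qed.

(** The test vector [invmx B *m g] attains the dual norm: its pairing with [g] is the square of its
    own primal norm, so one factor cancels. *)
Lemma dual_norm_le_inner g (C : R) : 0 <= C ->
  (forall v, inner g v <= C * primal_norm B v) -> dual_norm B g <= C.
Proof.
move=> C0 gC; have [/le_trans->//|g0] := leP (dual_norm B g) 0.
have := gC (invmx B *m g); rewrite -dual_normE.
suff -> : inner g (invmx B *m g) = dual_norm B g ^+ 2 by rewrite expr2 ler_pM2r.
by rewrite dual_normE sqr_primal_norm mulmxBV.
Qed.

(** Supplies the boundedness without which the [sup] in [op_norm] would not be an upper bound.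
    Coordinates of [v] are controlled by Cauchy-Schwarz against the representatives of the basis
    vectors, and [A *m v] is expanded in columns. *)
Lemma dual_norm_mulmx_bounded A :
  exists K : R, forall v, dual_norm B (A *m v) <= K * primal_norm B v.
Proof.
pose b i := primal_norm B (invmx B *m delta_mx i 0).
have coordB v i : `|v i 0| <= b i * primal_norm B v.
  have E w : w i 0 = inner (B *m (invmx B *m delta_mx i 0)) w.
    by rewrite mulmxBV /inner trmx_delta -rowE mxE.
  rewrite ler_norml; apply/andP; split; last by rewrite E cauchy_schwarz_innerB.
  rewrite lerNl -primal_normN (_ : - v i 0 = (- v) i 0) ?[RHS]mxE // E.
  exact: cauchy_schwarz_innerB.
exists (\sum_i b i * dual_norm B (col i A)) => v.
have -> : A *m v = \sum_i v i 0 *: col i A.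
  apply/matrixP => i j; rewrite ord1 mxE summxE; apply: eq_bigr => l _.
  by rewrite !mxE mulrC.
rewrite mulr_suml; elim/big_ind2 : _ => [|x1 y1 x2 y2 h1 h2|i _].
- by rewrite dual_normE mulmx0 primal_norm0.
- by rewrite (le_trans (dual_normD _ _)) ?lerD.
- by rewrite dual_normZ mulrAC ler_wpM2r ?dual_norm_ge0.
Qed.

Lemma dual_norm_mulmx A v :
  dual_norm B (A *m v) <= op_norm B A * primal_norm B v.
Proof.
have [->|v0] := eqVneq v 0.
  by rewrite mulmx0 dual_normE mulmx0 primal_norm0 mulr0.
have n0 := primal_norm_gt0 _ v0.
rewrite -ler_pdivrMr //.
have -> : dual_norm B (A *m v) / primal_norm B v =
    dual_norm B (A *m ((primal_norm B v)^-1 *: v)).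
  by rewrite -scalemxAr dual_normZ gtr0_norm ?invr_gt0 // mulrC.
apply: ub_le_sup.
  have [K KA] := dual_norm_mulmx_bounded A.
  exists `|K| => _ [w /= w1 <-]; rewrite (le_trans (KA w)) //.
  rewrite (le_trans (ler_wpM2r (primal_norm_ge0 w) (ler_norm K))) //.
  by rewrite ler_piMr.
by exists ((primal_norm B v)^-1 *: v) => //=;
  rewrite primal_normZ gtr0_norm ?invr_gt0 // mulVf ?gt_eqF.
Qed.

(** Coercivity against duality, with one factor of the norm of [v] cancelled. It bounds both the
    distance between two points and the length of a step. *)
Lemma primal_norm_le_dual_of_inner (mu : R) g v : 0 < mu ->
  mu * primal_norm B v ^+ 2 <= inner g v ->
  primal_norm B v <= dual_norm B g / mu.
Proof.
move=> mu0 H; rewrite ler_pdivlMr // mulrC.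
have [->|/primal_norm_gt0 n0] := eqVneq v 0.
  by rewrite primal_norm0 mulr0 dual_norm_ge0.
rewrite -(ler_pM2r n0) -mulrA -expr2 (le_trans H) //.
exact: dual_norm_inner.
Qed.

End PosDef.

(** * Gradient estimates for one step of the method *)

Section StronglyConvex.
Variables (R : realType) (d : nat) (B : 'M[R]_d) (f : 'cV[R]_d -> R).
Variables (L mu : R).
Hypotheses (hB : sym_posdef B) (hf : twice_continuously_differentiable f).
Hypotheses (hL : 0 < L) (hLip : hessian_lipschitz B L f).
Hypotheses (hmu : 0 < mu) (hconv : strongly_convex B mu f).
Implicit Types (x z v : 'cV[R]_d).

Let gnorm x := dual_norm B (gradient f x).

Lemma strongly_convex_hessian x v :
  mu * primal_norm B v ^+ 2 <= inner (hessian f x *m v) v.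
Proof.
have := hconv x v.
by rewrite mulmxBl innerDl innerNl -scalemxAl innerZl subr_ge0 sqr_primal_norm.
Qed.

Lemma primal_dist_le_gradient x z :
  primal_norm B (x - z) <= (gnorm x + gnorm z) / mu.
Proof.
have [_ dG _] := hf.
(* Testing against the displacement [x - z] itself yields a quadratic form of the Hessian, which
   strong convexity bounds below. *)
have [c _] := @gradient_mean_value R d f z (x - z) (x - z) dG.
rewrite subrKC => E.
have := primal_norm_le_dual_of_inner _ _ _ hB _
  (gradient f x - gradient f z) (x - z) hmu.
rewrite E => /(_ (strongly_convex_hessian _ _)) /le_trans; apply.
rewrite ler_pM2r ?invr_gt0 //.
by rewrite (le_trans (dual_normD _ _ _ hB _ _)) ?dual_normN.
Qed.

Lemma hessian_regularized_unitmx x (l : R) :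
  0 <= l -> hessian f x + l *: B \in unitmx.
Proof.
move=> l0; apply: unitmx_inner_gt0 => v /(primal_norm_gt0 _ _ _ hB) n0.
rewrite mulmxDl innerDl -scalemxAl innerZl ltr_pwDl //; last first.
  by rewrite mulr_ge0 // innerB_ge0.
apply: lt_le_trans (strongly_convex_hessian x v).
by rewrite mulr_gt0 // exprn_gt0.
Qed.

(** The intermediate Hessian sits at [x + c *: h], whose distance to [z] is at most that of [x] plus
    [c] times the norm of [h]; then [c] is bounded by 1. *)
Lemma gradient_taylor x z h :
  dual_norm B (gradient f (x + h) - gradient f x - hessian f z *m h) <=
  L * (primal_norm B (x - z) + primal_norm B h) * primal_norm B h.
Proof.
have [_ dG _] := hf.
apply: (dual_norm_le_inner _ _ _ hB) => [|u].
  by rewrite !mulr_ge0 ?addr_ge0 ?primal_norm_ge0 // ltW.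
have [c /andP[c0 c1] E] := @gradient_mean_value R d f x h u dG.
rewrite innerDl E innerNl -innerNl -innerDl -mulmxBl.
apply: (le_trans (dual_norm_inner _ _ _ hB _ _)).
rewrite ler_wpM2r ?primal_norm_ge0 //.
apply: (le_trans (dual_norm_mulmx _ _ _ hB _ _)).
rewrite ler_wpM2r ?primal_norm_ge0 // (le_trans (hLip _ _)) // ler_pM2l //.
rewrite addrAC (le_trans (primal_normD _ _ _ hB _ _)) // lerD2l primal_normZ //.
by rewrite gtr0_norm // ler_piMl ?primal_norm_ge0 // ltW.
Qed.

Lemma lazy_newton_step x z (l : R) : 0 <= l ->
  gnorm (x - invmx (hessian f z + l *: B) *m gradient f x) <=
  L / mu ^+ 2 * (2 * gnorm x + gnorm z) * gnorm x + l / mu * gnorm x.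
Proof.
move=> l0; set A := hessian f z + l *: B; set h := - (invmx A *m gradient f x).
have Ah : A *m h = - gradient f x.
  by rewrite mulmxN mulmxA mulmxV ?mul1mx ?hessian_regularized_unitmx.
(* Since [l] is nonnegative, [A] keeps the lower bound [mu *: B], and [A *m h] is minus the
   gradient. *)
have hle : primal_norm B h <= gnorm x / mu.
  rewrite -[gnorm x](dual_normN _ _ _ hB).
  apply: primal_norm_le_dual_of_inner => //.
  rewrite -Ah mulmxDl innerDl -scalemxAl innerZl.
  rewrite (le_trans (strongly_convex_hessian z h)) // lerDl.
  by rewrite mulr_ge0 // innerB_ge0.
(* The step equation [Ah] writes the new gradient as a Taylor remainder minus the regularization
   term. *)
have -> : gnorm (x + h) = dual_norm B
    (gradient f (x + h) - gradient f x - hessian f z *m h - l *: (B *m h)).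
  rewrite -Ah mulmxDl -scalemxAl.
  by rewrite -addrA -opprD addrK.
rewrite (le_trans (dual_normD _ _ _ hB _ _)) // dual_normN // dual_normZ //.
rewrite dual_norm_mulB // ger0_norm //; apply: lerD; last first.
  by rewrite -mulrA (mulrC mu^-1) ler_wpM2l.
apply: (le_trans (gradient_taylor _ _ _)).
have -> : L / mu ^+ 2 * (2 * gnorm x + gnorm z) * gnorm x =
   L * ((gnorm x + gnorm z) / mu + gnorm x / mu) * (gnorm x / mu).
  by field; rewrite gt_eqF.
have D := primal_dist_le_gradient x z.
by rewrite ler_pM ?mulr_ge0 ?addr_ge0 ?primal_norm_ge0 ?ler_wpM2l ?lerD // ltW.
Qed.

End StronglyConvex.

(** Here [b] and [t ^+ 2] bound the gradient norms at the iterate and at the snapshot, relative to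
    [G0]. The two parts of the denominator of [G0] serve the two error terms: [3 * L] makes the
    Hessian error factor at most [t / 16], using [t <= 1 / 2], and [4 * M] makes the regularization
    factor at most [t / 4]. *)
Lemma lazy_newton_step_contraction (R : realType) (L mu M g gz b t : R) :
  0 < L -> 0 < mu -> 0 <= M -> 0 <= g -> 0 < t <= 1 / 2 -> b <= t ^+ 2 ->
  let G0 := mu ^+ 2 / (2 ^+ 3 * (3 * L + 4 * M)) in
  g <= G0 * b -> gz <= G0 * t ^+ 2 ->
  L / mu ^+ 2 * (2 * g + gz) * g + Num.sqrt (M * g) / mu * g <= G0 * (b * t).
Proof.
move=> L0 mu0 M0 g0 /andP[t0 t12] bt G0 gb gzt.
have D0 : 0 < 3 * L + 4 * M by lra.
have G0_gt0 : 0 < G0 by rewrite divr_gt0 ?exprn_gt0 ?mulr_gt0.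
have mu2 : 0 < mu ^+ 2 by rewrite exprn_gt0.
have gt2 : g <= G0 * t ^+ 2 by rewrite (le_trans gb) // ler_pM2l.
have cL : L / mu ^+ 2 * (2 * g + gz) <= t / 16.
  rewrite (@le_trans _ _ (L / mu ^+ 2 * (3 * (G0 * t ^+ 2)))) //.
    by rewrite ler_pM2l ?divr_gt0 //; lra.
  have -> : L / mu ^+ 2 * (3 * (G0 * t ^+ 2)) =
            (3 * L / (3 * L + 4 * M)) * (t ^+ 2 / 8).
    by rewrite /G0; field; rewrite !gt_eqF.
  rewrite (@le_trans _ _ (1 * (t ^+ 2 / 8))) //; last by nra.
  by rewrite ler_pM2r ?divr_gt0 ?exprn_gt0 // ler_pdivrMr //; lra.
have cM : Num.sqrt (M * g) / mu <= t / 4.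
  rewrite ler_pdivrMr // -[leRHS]ger0_norm; last first.
    by rewrite ltW // mulr_gt0 // divr_gt0.
  rewrite -sqrtr_sqr ler_wsqrtr // (le_trans (ler_wpM2l M0 gt2)) //.
  have -> : M * (G0 * t ^+ 2) =
            (4 * M / (3 * L + 4 * M)) * (mu ^+ 2 * t ^+ 2 / 32).
    by rewrite /G0; field; rewrite gt_eqF.
  rewrite (@le_trans _ _ (1 * (mu ^+ 2 * t ^+ 2 / 32))) //.
    by rewrite ler_pM2r ?divr_gt0 ?mulr_gt0 ?exprn_gt0 // ler_pdivrMr //; lra.
  by have := mulr_gt0 mu2 (exprn_gt0 2 t0); rewrite exprMn; lra.
rewrite -mulrDl (@le_trans _ _ (t * g)) ?ler_wpM2r //; first by lra.
by rewrite mulrC (mulrC b) mulrA (mulrC G0) -mulrA (mulrC g) ler_pM2l.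
Qed.

(** * Induction over phases and over the steps of a phase *)

Lemma phase_start_div (m k : nat) : (phase_start m k %/ m = k %/ m)%N.
Proof.
rewrite /phase_start {1}(divn_eq k m) addnK.
by case: m => [|m]; [rewrite !divn0|rewrite mulnK].
Qed.

Lemma phase_startMD (m p j : nat) : (j < m)%N ->
  phase_start m (p * m + j)%N = (p * m)%N.
Proof. by move=> jm; rewrite /phase_start modnMDl modn_small // addnK. Qed.

Theorem theorem5p3 (R : realType) (d : nat) (B : 'M[R]_d)
    (f : 'cV[R]_d -> R) (L mu M : R) (m : nat) (x : nat -> 'cV[R]_d)
    (hB : sym_posdef B)
    (hf : twice_continuously_differentiable f)
    (hL : 0 < L) (hLip : hessian_lipschitz B L f)
    (hmu : 0 < mu) (hconv : strongly_convex B mu f)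
    (hM : 0 <= M) (hm : (1 <= m)%N)
    (hx : lazy_newton_iterates B M m f x) :
  let G0 : R := mu ^+ 2 / (2 ^+ 3 * (3 * L + 4 * M)) in
  dual_norm B (gradient f (x 0%N)) <= 1 / 2 ^+ 2 * G0 ->
  forall k : nat,
    dual_norm B (gradient f (x k)) <=
      G0 * (1 / 2) `^ (2 * (1 + m%:R / 2) ^+ (phase_start m k %/ m)
                         * (1 + (k %% m)%:R / 2)).
Proof.
move=> G0 hx0.
pose P p : R := 2 * (1 + m%:R / 2) ^+ p.
have half_gt0 : 0 < 1 / 2 :> R by lra.
have m1 : 1 <= 1 + m%:R / 2 :> R by rewrite lerDl divr_ge0.
have P2 p : 2 <= P p by rewrite ler_pMr // exprn_ege1.
(* The case [j = m] is included on purpose: it is the snapshot of the next phase, with exponent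
   [P p * (1 + m%:R / 2) = P p.+1]. *)
suff claim p j : (j <= m)%N -> dual_norm B (gradient f (x (p * m + j)%N)) <=
    G0 * (1 / 2) `^ (P p * (1 + j%:R / 2)).
  move=> k; rewrite phase_start_div {1}(divn_eq k m).
  by apply: claim; rewrite ltnW // ltn_pmod.
have in_phase q :
    dual_norm B (gradient f (x (q * m)%N)) <= G0 * (1 / 2) `^ P q ->
    forall i, (i <= m)%N -> dual_norm B (gradient f (x (q * m + i)%N)) <=
    G0 * (1 / 2) `^ (P q * (1 + i%:R / 2)).
  move=> start; elim=> [|i IH] im; first by rewrite addn0 mul0r addr0 mulr1.
  have := hx (q * m + i)%N; rewrite /= phase_startMD // addnS => ->.
  have reg0 : 0 <= regularizer B M f (x (q * m + i)%N) by exact: sqrtr_ge0.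
  apply: (le_trans
    (lazy_newton_step _ _ _ _ _ _ hB hf hL hLip hmu hconv _ _ _ reg0)).
  (* The square root of the relative bound at the snapshot. Multiplying by [t] adds [P q / 2] to the
     exponent, exactly the increment from [i] to [i.+1]. *)
  set t := (1 / 2 : R) `^ (P q / 2).
  have t2 : (1 / 2) `^ P q = t ^+ 2.
    by rewrite -powR_mulrn ?powR_ge0 // -powRrM mulfVK // pnatr_eq0.
  have -> : (1 / 2) `^ (P q * (1 + i.+1%:R / 2)) =
            (1 / 2) `^ (P q * (1 + i%:R / 2)) * t.
    rewrite -powRD; last by apply/implyP => _; rewrite gt_eqF.
    by congr (_ `^ _); rewrite -natr1; field.
  apply: lazy_newton_step_contraction => //.
  - exact: sqrtr_ge0.
  (* The bound [t <= 1 / 2] comes from [P q >= 2]. *)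
  - rewrite powR_gt0 //=.
    have -> : 1 / 2 = (1 / 2) `^ 1 :> R by rewrite powRr1 // ltW.
    by apply: ger_powR; [lra|have := P2 q; lra].
  - rewrite -t2; apply: ger_powR; first by lra.
    by rewrite ler_peMr ?(le_trans _ (P2 q)) // lerDl divr_ge0.
  - exact/IH/ltnW.
  - by rewrite -t2.
(* The first snapshot has exponent [P 0 = 2], matching the factor 1/4 assumed of the initial
   gradient; each later one is the case [j = m] of the preceding phase. *)
elim: p j => [|p IH] j; apply: in_phase.
  rewrite mul0n /P expr0 mulr1 powR_mulrn ?divr_ge0 //.
  by rewrite expr_div_n expr1n mulrC.
by rewrite mulSnr (le_trans (IH m _)) // /P exprSr mulrA.
Qed.
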